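(* Let $\Theta$ be a finite set, $(\pi,A)$ a decision problem, and let $P\in\Delta(A)^\Theta$ be a choice rule that is optimal under Csiszár information with transformation $\phi$ essentially smooth. For any comparable actions $a,b\in A$, the following are equivalent: (i) Action $a$ is more salient than action $b$. (ii) $\alpha(a)\ge\alpha(b)$, where $\alpha$ is the $f$-mean of $P$.
   Context: A decision problem $(\pi,A)$ consists of a full-support prior $\pi\in\Delta(\Theta)$ and a finite nonempty set of actions $A\subset\mathbb{R}^\Theta$ ($a(\theta)$ is the utility of $a$ in state $\theta$). A transformation is a convex, lower semicontinuous $\phi:\mathbb{R}_+\to[0,+\infty]$ with $\phi(1)=0$ which (standing assumption) is superlinear at infinity ($\phi(t)/t\to+\infty$ as $t\to+\infty$), strictly convex on $\operatorname{int}(\operatorname{dom}\phi)$, and satisfies $1\in\operatorname{int}(\operatorname{dom}\phi)$. $\phi$ is essentially smooth if it is finite and differentiable on $(0,+\infty)$ and $\lim_{t\to0}\phi'(t)=-\infty$. The Csiszár information of $P\in\Delta(A)^\Theta$ is $$I(P,\pi)=\min_{\alpha\in\Delta(A)}\sum_{\theta}\pi(\theta)\sum_{a\in A}\alpha(a)\phi\Big(\frac{P_\theta(a)}{\alpha(a)}\Big),$$ with $0\cdot\phi(x/0)=\lim_{t\to+\infty}\phi(1+tx)/t$; a minimizer $\alpha$ is the $f$-mean of $P$. $P$ is optimal if it maximizes $\sum_\theta\pi(\theta)\sum_aP_\theta(a)a(\theta)-I(P,\pi)$ over $\Delta(A)^\Theta$. Given $(\pi,A)$ and $P$, action $a$ is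 more salient than action $b$ if, for every $\theta\in\Theta$, $a(\theta)=b(\theta)$ implies $P_\theta(a)\ge P_\theta(b)$. Actions $a,b$ are comparable if there is a state $\theta\in\Theta$ with $a(\theta)=b(\theta)$. *)

(* Defs.v *)
From HB Require Import structures.
From mathcomp Require Export all_boot all_order all_algebra.
From mathcomp Require Export finmap.
From mathcomp Require Export all_classical all_reals all_analysis.

Set Implicit Arguments.
Unset Strict Implicit.
Unset Printing Implicit Defensive.

Import Order.TTheory GRing.Theory Num.Theory.
Import numFieldNormedType.Exports.

Local Open Scope classical_set_scope.
Local Open Scope ring_scope.

Definition Delta (R : realType) (T : finType) : set (T -> R) :=
  [set p | (forall x, 0 <= p x) /\ \sum_(x : T) p x = 1].

(* An action [a] is identified with its payoff vector: [a theta] is its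
   utility in state [theta]. *)
Definition action (R : realType) (Theta : finType) := {ffun Theta -> R}.

Definition decision_problem (R : realType) (Theta : finType)
    (pi : Theta -> R) (A : {fset action R Theta}) : Prop :=
  [/\ Delta pi, (forall theta, 0 < pi theta) & A != fset0].

Definition choice_rule (R : realType) (Theta : finType)
    (A : {fset action R Theta}) : set (Theta -> A -> R) :=
  [set P | forall theta, Delta (P theta)].

(* A function on [0, +oo[ is represented by a total function on [R]; its
   values at negative reals are never used. *)
Definition halfline (R : realType) : set R := [set t | 0 <= t].

Definition effective_domain (R : realType) (phi : R -> \bar R) : set R :=
  [set t | 0 <= t /\ (phi t < +oo)%E].

Definition convex_on (R : realType) (D : set R) (phi : R -> \bar R) : Prop :=
  forall s t l : R, D s -> D t -> 0 <= l <= 1 ->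
  (phi (l * s + (1 - l) * t)%R <= l%:E * phi s + (1 - l)%R%:E * phi t)%E.

Definition strictly_convex_on (R : realType) (D : set R) (phi : R -> \bar R) :
    Prop :=
  forall s t l : R, D s -> D t -> s != t -> 0 < l < 1 ->
  (phi (l * s + (1 - l) * t)%R < l%:E * phi s + (1 - l)%R%:E * phi t)%E.

(* Lower semicontinuity is relative to [0, +oo[; the interior of the domain is
   taken in [R], so it never contains 0. *)
Record transformation (R : realType) (phi : R -> \bar R) : Prop := {
  transformation_ge0 : forall t : R, 0 <= t -> (0 <= phi t)%E;
  transformation_convex : convex_on (@halfline R) phi;
  transformation_lsc :
    lower_semicontinuous (phi : subspace (@halfline R) -> \bar R);
  transformation1 : phi 1 = 0%E;
  transformation_superlinear : (phi t * (t^-1)%:E)%E @[t --> +oo%R] --> +oo%E;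
  transformation_strictly_convex :
    strictly_convex_on (interior (effective_domain phi)) phi;
  transformation_1_interior : interior (effective_domain phi) 1 }.

Definition essentially_smooth (R : realType) (phi : R -> \bar R) : Prop :=
  [/\ forall t : R, 0 < t -> phi t \is a fin_num,
      forall t : R, 0 < t -> derivable (fine \o phi) t 1
    & derive1 (fine \o phi) t @[t --> 0^'+] --> -oo%R].

(* [y * phi (x / y)], with [0 * phi (x / 0)] read as the recession limit. *)
Definition perspective (R : realType) (phi : R -> \bar R) (x y : R) : \bar R :=
  if y == 0 then lim ((phi (1 + t * x)%R * (t^-1)%:E)%E @[t --> +oo%R])
  else (y%:E * phi (x / y)%R)%E.

Section Csiszar.
Variables (R : realType) (Theta : finType) (phi : R -> \bar R).
Variables (pi : Theta -> R) (A : {fset action R Theta}).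
Implicit Types (P Q : Theta -> A -> R) (alpha beta : A -> R).

Definition divergence P alpha : \bar R :=
  (\sum_(theta : Theta)
     (pi theta)%:E * \sum_(a : A) perspective phi (P theta a) (alpha a))%E.

Definition csiszar_information P : \bar R :=
  ereal_inf [set divergence P alpha | alpha in @Delta R A].

Definition fmean P alpha : Prop :=
  Delta alpha /\ forall beta, Delta beta ->
    (divergence P alpha <= divergence P beta)%E.

Definition net_payoff P : \bar R :=
  ((\sum_(theta : Theta) pi theta * \sum_(a : A) P theta a * (val a) theta)%R%:E
   - csiszar_information P)%E.

Definition optimal P : Prop :=
  choice_rule P /\ forall Q, choice_rule Q -> (net_payoff Q <= net_payoff P)%E.

Definition more_salient P (a b : A) : Prop :=
  forall theta, (val a) theta = (val b) theta -> P theta b <= P theta a.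

Definition comparable_actions (a b : A) : Prop :=
  exists theta, (val a) theta = (val b) theta.

End Csiszar.

(* Main.v *)
(** The rule [P] and its f-mean [alpha] jointly maximize payoff minus divergence,
    so each [P theta] is optimal for the statewise problem with [alpha] fixed.
    Essential smoothness forces [P theta c > 0] as soon as [alpha c > 0], while
    superlinearity forces [P theta c = 0] when [alpha c = 0].  If [a] and [b]
    have the same payoff in [theta] and positive [alpha], strict convexity gives
    [P theta a / alpha a = P theta b / alpha b].  Hence, in any state where [a]
    and [b] tie, [P theta] ranks them as [alpha] does. *)
From mathcomp Require Import ring lra.
Require Import Defs.
Set Implicit Arguments.
Unset Strict Implicit.
Unset Printing Implicit Defensive.
Import Order.TTheory GRing.Theory Num.Theory numFieldNormedType.Exports.
Local Open Scope classical_set_scope.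
Local Open Scope ring_scope.

(** With [l = - h / t], the hypothesis says that each left difference quotient of [f] at [t] is at
    least the secant slope [(f t - f 0) / t]; let [h] tend to 0. *)
Lemma le_secant0_derive1 (R : realType) (f : R -> R) (t : R) :
  (forall l, 0 < l < 1 -> f ((1 - l) * t) <= (1 - l) * f t + l * f 0) ->
  0 < t -> derivable f t 1 -> f t - f 0 <= t * derive1 f t.
Proof.
move=> fconv t0 df; rewrite mulrC -ler_pdivrMr// derive1E /derive.
have /cvg_dnbhs_at_left dfl := df.
rewrite -(cvg_lim (@Rhausdorff R) dfl).
apply: limr_ge; first by apply/cvg_ex; eexists; exact: dfl.
have nt0 : - t < 0 by rewrite oppr_lt0.
near=> h.
have h0 : h < 0 by near: h; exact: nbhs_left_lt.
have th : - t < h by near: h; exact: nbhs_left_gt.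
have lh : 0 < - h / t < 1.
  by rewrite divr_gt0 ?oppr_gt0//= ltr_pdivrMr// mul1r; lra.
have := fconv _ lh.
have -> : (1 - - h / t) * t = h + t by field; rewrite gt_eqF.
rewrite /= -[h *: 1]/(h * 1) mulr1 -[h^-1 *: _]/(h^-1 * _) [h^-1 * _]mulrC => Hf.
rewrite ler_ndivlMr// -(ler_pM2r t0).
have -> : (f t - f 0) / t * h * t = (f t - f 0) * h by field; rewrite gt_eqF.
rewrite -(ler_pM2r t0) in Hf; move: Hf.
have -> : ((1 - - h / t) * f t + - h / t * f 0) * t = t * f t + h * (f t - f 0).
  by field; rewrite gt_eqF.
lra.
Unshelve. all: by end_near. Qed.

(** * Transformations and their perspectives *)

Section Transformation.
Variables (R : realType) (phi : R -> \bar R).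
Hypothesis hphi : transformation phi.

Lemma perspectivex0 (x : R) : 0 < x -> perspective phi x 0 = +oo%E.
Proof.
move=> x0; rewrite /perspective eqxx; apply: cvg_lim => //.
have /cvgeyPge sup := transformation_superlinear hphi.
apply/cvgeyPge => M.
(* Past [N], [phi u / u] is at least [|M| / x]; at [u = 1 + t * x], where [u / t > x], this yields
   [phi u / t >= |M|]. *)
have [N [Nr HN]] := sup (`|M| / x).
near=> t.
have t0 : 0 < t by near: t; exact: nbhs_pinfty_gt.
have tN : N / x < t by near: t; apply: nbhs_pinfty_gt; rewrite num_real.
have xt0 : 0 < t * x by rewrite mulr_gt0.
have Nt : N < 1 + t * x by rewrite ltr_pdivrMr// in tN; lra.
have := HN _ Nt.
have := @transformation_ge0 _ _ hphi (1 + t * x) ltac:(lra).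
case: (phi (1 + t * x)) => [r| |]//= r0.
  rewrite -!EFinM !lee_fin ler_pdivlMr; last lra.
  rewrite ler_pdivlMr// => Hr.
  apply: le_trans Hr; apply: (@le_trans _ _ (`|M| * t)).
    by rewrite ler_pM2r// ler_norm.
  have -> : `|M| / x * (1 + t * x) = `|M| * t + `|M| / x.
    by field; rewrite gt_eqF.
  by rewrite lerDl divr_ge0// ltW.
by move=> _; rewrite gt0_mulye ?leey// lte_fin invr_gt0.
Unshelve. all: by end_near. Qed.

(** At [y = 0] the recession quotient is constantly [phi 1 / t = 0]. *)
Lemma perspective_diag (y : R) : perspective phi y y = 0%E.
Proof.
rewrite /perspective; case: eqVneq => [->|y0].
  rewrite (_ : (fun t => _) = cst 0%E) ?lim_cst//.
  by apply/funext => t; rewrite mulr0 addr0 (transformation1 hphi) mul0e.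
by rewrite divff// (transformation1 hphi) mule0.
Qed.

Lemma perspective_ge0 (x y : R) : 0 <= x -> 0 <= y ->
  (0 <= perspective phi x y)%E.
Proof.
move=> x0 y0; have [->|yn0] := eqVneq y 0.
  move: x0; rewrite le_eqVlt => /predU1P[<-|x0].
    by rewrite perspective_diag.
  by rewrite perspectivex0.
rewrite /perspective (negbTE yn0) mule_ge0 ?lee_fin//.
by apply: (transformation_ge0 hphi); rewrite divr_ge0.
Qed.

Lemma perspective_gt0E (x y : R) : 0 < y ->
  perspective phi x y = (y%:E * phi (x / y))%E.
Proof. by move=> y0; rewrite /perspective gt_eqF. Qed.

Lemma fine_convex (s t l : R) : 0 <= s -> 0 <= t -> 0 <= l <= 1 ->
  phi s \is a fin_num -> phi t \is a fin_num ->
  fine (phi (l * s + (1 - l) * t)) <= l * fine (phi s) + (1 - l) * fine (phi t).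
Proof.
move=> s0 t0 l01 /fineK fs /fineK ft.
have := transformation_convex hphi s0 t0 l01.
rewrite -fs -ft -!EFinM -EFinD /=.
(* Nonnegativity excludes -oo, which [fine] would send to the default 0. *)
have : (0 <= phi (l * s + (1 - l) * t))%E.
  by case/andP: l01 => *; rewrite (transformation_ge0 hphi)// addr_ge0//
      mulr_ge0// subr_ge0.
by case: (phi (l * s + _)).
Qed.

(** * Consequences of essential smoothness *)

Hypothesis hsmooth : essentially_smooth phi.

Lemma fine_strictly_convex (s t l : R) : 0 < s -> 0 < t -> s != t ->
  0 < l < 1 ->
  fine (phi (l * s + (1 - l) * t)) < l * fine (phi s) + (1 - l) * fine (phi t).
Proof.
have [fin_phi _ _] := hsmooth.
have int_dom x : 0 < x -> interior (effective_domain phi) x.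
  move=> x0; rewrite /interior /=; near=> z.
  have z0 : 0 < z by near: z; exact: lt_nbhsr.
  by split; [exact: ltW | rewrite ltey_eq fin_phi].
move=> s0 t0 st l01.
have := transformation_strictly_convex hphi (int_dom _ s0) (int_dom _ t0) st l01.
rewrite -(fineK (fin_phi _ s0)) -(fineK (fin_phi _ t0)).
rewrite -[phi (l * s + _)]fineK ?fin_phi//.
by case/andP: l01 => l0 l1; rewrite addr_gt0// mulr_gt0// subr_gt0.
Unshelve. all: by end_near. Qed.

(** The secant slope of [phi] over [[0, l]] is at most its derivative at [l], which tends to -oo as
    [l] tends to 0. *)
Lemma slope0_unbounded (M : R) : phi 0 \is a fin_num ->
  exists2 l, 0 < l < 1 & fine (phi l) - fine (phi 0) < l * M.
Proof.
have [fin_phi dphi /cvgrNyPlt dphiN] := hsmooth => fin0.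
near (0 : R)^'+ => l.
have l0 : 0 < l by near: l; exact: nbhs_right_gt.
have l1 : l < 1 by near: l; exact: nbhs_right_lt.
exists l; first by rewrite l0.
apply: (@le_lt_trans _ _ (l * derive1 (fine \o phi) l)).
  apply: (@le_secant0_derive1 _ (fine \o phi)) => // [k /andP[k0 k1]|];
    last exact: dphi.
  have := @fine_convex l 0 (1 - k) (ltW l0) (lexx _) _ (fin_phi _ l0) fin0.
  rewrite mulr0 addr0 subKr; apply; lra.
by rewrite ltr_pM2l//; near: l; exact: dphiN.
Unshelve. all: by end_near. Qed.

End Transformation.

(** * Statewise optimality with the f-mean held fixed *)

Section Optimality.
Variables (R : realType) (Theta : finType) (phi : R -> \bar R).
Variables (pi : Theta -> R) (A : {fset action R Theta}).
Variables (P : Theta -> A -> R) (alpha : A -> R).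
Hypotheses (hphi : transformation phi) (hsmooth : essentially_smooth phi).
Hypotheses (hpiA : decision_problem pi A) (hP : optimal phi pi P).
Hypothesis halpha : fmean phi pi P alpha.

(** Objective in one state for fixed [alpha]; real-valued through [fine], hence faithful only where
    every perspective term is finite. *)
Definition state_value (theta : Theta) (q : A -> R) : R :=
  \sum_(c : A) q c * (val c) theta
  - \sum_(c : A) fine (perspective phi (q c) (alpha c)).

Lemma divergence_ge0 (Q : Theta -> A -> R) (beta : A -> R) :
  choice_rule Q -> Delta beta -> (0 <= divergence phi pi Q beta)%E.
Proof.
have [[pi0 _] _ _] := hpiA => hQ [beta0 _].
apply: sume_ge0 => theta _; apply: mule_ge0; first by rewrite lee_fin.
apply: sume_ge0 => c _; apply: perspective_ge0 => //.
by have [+ _] := hQ theta; exact.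
Qed.

Lemma fmeanE : csiszar_information phi pi P = divergence phi pi P alpha.
Proof.
have [alphaD alpha_min] := halpha; apply/eqP; rewrite eq_le; apply/andP; split.
  by apply: ereal_inf_lbound; exists alpha.
by apply: le_ereal_inf_tmp => _ [beta betaD <-]; exact: alpha_min.
Qed.

(** Choosing according to [alpha] in every state costs no information, so the optimal net payoff
    exceeds -oo. *)
Lemma divergence_fin_num : divergence phi pi P alpha \is a fin_num.
Proof.
have [alphaD _] := halpha; have [Pc optP] := hP.
have Qc : choice_rule (fun _ : Theta => alpha) by move=> theta.
have div0 : divergence phi pi (fun=> alpha) alpha = 0%E.
  rewrite /divergence big1// => theta _.
  by rewrite big1 ?mule0// => c _; exact: perspective_diag.
have I0 : (csiszar_information phi pi (fun _ : Theta => alpha) <= 0)%E.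
  by rewrite -div0; apply: ereal_inf_lbound; exists alpha.
rewrite ge0_fin_numE ?divergence_ge0//.
have := optP _ Qc; rewrite /net_payoff fmeanE.
case: (divergence phi pi P alpha) => [r||]//; first by rewrite ltry.
rewrite addeNy leeNy_eq adde_eq_ninfty/= => /eqP.
by move: I0; case: csiszar_information.
Qed.

(** All terms are nonnegative and [pi] has full support, so one infinite term would make the whole
    divergence infinite. *)
Lemma perspective_fin_num theta c :
  perspective phi (P theta c) (alpha c) \is a fin_num.
Proof.
have [[alpha0 _] _] := halpha; have [Pc _] := hP; have [_ pi_gt0 _] := hpiA.
have pers0 t d : (0 <= perspective phi (P t d) (alpha d))%E.
  by apply: perspective_ge0 => //; have [+ _] := Pc t; exact.
have /sum_fin_numP/(_ theta (mem_index_enum _) isT) := divergence_fin_num.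
have : (0 <= \sum_(a : A) perspective phi (P theta a) (alpha a))%E by exact: sume_ge0.
case E : (\sum_(a : A) perspective phi (P theta a) (alpha a))%E => [r||]// _ H.
  have /sum_fin_numP/(_ c (mem_index_enum _) isT)// :
    (\sum_(a : A) perspective phi (P theta a) (alpha a))%E \is a fin_num by rewrite E.
by move: H; rewrite gt0_muley// lte_fin.
Qed.

Lemma choice_eq0 theta c : alpha c = 0 -> P theta c = 0.
Proof.
have [Pc _] := hP; have [/(_ c) + _] := Pc theta.
rewrite le_eqVlt => /predU1P[//|Ppos] alpha0.
by have := perspective_fin_num theta c; rewrite alpha0 perspectivex0.
Qed.

Lemma divergence_fine (Q : Theta -> A -> R) :
  (forall theta c, perspective phi (Q theta c) (alpha c) \is a fin_num) ->
  divergence phi pi Q alpha = (\sum_theta pi theta *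
    \sum_c fine (perspective phi (Q theta c) (alpha c)))%:E.
Proof.
move=> finQ; rewrite -sumEFin; apply: eq_bigr => theta _.
by rewrite EFinM EFin_sum_fine.
Qed.

(** Replace [P] by [q] in state [theta] only. Keeping [alpha] can only overestimate the information
    of the new rule, and the other states cancel. *)
Lemma state_value_max theta (q : A -> R) : Delta q ->
  (forall c, perspective phi (q c) (alpha c) \is a fin_num) ->
  state_value theta q <= state_value theta (P theta).
Proof.
move=> qD finq; have [Pc optP] := hP; have [_ pi_gt0 _] := hpiA.
pose Q t := if t == theta then q else P t.
have Qc : choice_rule Q by move=> t; rewrite /Q; case: eqP.
have finQ t c : perspective phi (Q t c) (alpha c) \is a fin_num.
  by rewrite /Q; case: eqP => // _; exact: perspective_fin_num.
have IQ : (csiszar_information phi pi Q <= divergence phi pi Q alpha)%E.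
  by apply: ereal_inf_lbound; exists alpha => //; have [] := halpha.
have : (\sum_t pi t * state_value t (Q t) <= \sum_t pi t * state_value t (P t)).
  have sv (S : Theta -> A -> R) : \sum_t pi t * state_value t (S t) =
      \sum_t pi t * \sum_(c : A) S t c * (val c) t
      - \sum_t pi t * \sum_(c : A) fine (perspective phi (S t c) (alpha c)).
    by rewrite -sumrB; apply: eq_bigr => t _; rewrite mulrBr.
  rewrite !sv -lee_fin !EFinB -!divergence_fine//; last exact: perspective_fin_num.
  rewrite -fmeanE; apply: le_trans (optP _ Qc).
  by rewrite leeD2l// leeN2.
rewrite (bigD1 theta)//= [leRHS](bigD1 theta)//= {1}/Q eqxx.
under eq_bigr => t /negbTE tn do rewrite /Q tn.
by rewrite lerD2r ler_pM2l.
Qed.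

(* Otherwise moving [P theta] slightly towards [alpha] would pay off: the
   payoff changes linearly, convexity and [phi 1 = 0] prevent any term of the
   divergence from increasing, and the term of [c] falls at an infinite rate. *)
Lemma choice_gt0 theta c : 0 < alpha c -> 0 < P theta c.
Proof.
move=> alphac; have [[alpha0 alpha1] _] := halpha; have [Pc _] := hP.
have [fin_phi _ _] := hsmooth.
have [P0 P1] := Pc theta.
rewrite lt_neqAle P0 andbT eq_sym; apply/eqP => Pc0.
have fin0 : phi 0 \is a fin_num.
  have := perspective_fin_num theta c.
  rewrite perspective_gt0E// Pc0 mul0r.
  have := transformation_ge0 hphi (lexx 0).
  by case: (phi 0) => //; rewrite gt0_muley.
pose K := \sum_(d : A) (alpha d - P theta d) * (val d) theta.
(* [K] is the payoff change per unit of [l]; the bound [K / alpha c] makes the payoff change [l * K]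
   exceed the change in the divergence term of [c]. *)
have [l /andP[l0 l1] slope] := slope0_unbounded hphi hsmooth (K / alpha c) fin0.
pose q (d : A) := (1 - l) * P theta d + l * alpha d.
have q0 d : 0 <= q d.
  by rewrite addr_ge0// mulr_ge0// ?subr_ge0 ltW.
have qD : Delta q.
  by split=> //; rewrite big_split/= -!mulr_sumr P1 alpha1; lra.
(* The new likelihood ratio lies between the old one and 1, where [phi] vanishes. *)
have qE d : 0 < alpha d ->
    q d / alpha d = (1 - l) * (P theta d / alpha d) + (1 - (1 - l)) * 1.
  by move=> ad; rewrite /q; field; rewrite gt_eqF.
have finq d : perspective phi (q d) (alpha d) \is a fin_num.
  have := alpha0 d; rewrite le_eqVlt => /predU1P[ad|ad].
    by rewrite /q (choice_eq0 theta (esym ad)) -ad !mulr0 addr0 perspective_diag.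
  rewrite perspective_gt0E// fin_numM// fin_phi// divr_gt0//.
  by rewrite /q ltr_wpDl ?mulr_gt0// mulr_ge0// subr_ge0 ltW.
have le_term d : fine (perspective phi (q d) (alpha d)) <=
                 fine (perspective phi (P theta d) (alpha d)).
  have := alpha0 d; rewrite le_eqVlt => /predU1P[ad|ad].
    by rewrite /q (choice_eq0 theta (esym ad)) -ad !mulr0 addr0.
  have finP := perspective_fin_num theta d.
  have r0 : 0 <= P theta d / alpha d by rewrite divr_ge0.
  have finr : phi (P theta d / alpha d) \is a fin_num.
    move: finP; rewrite perspective_gt0E//.
    have := transformation_ge0 hphi r0.
    by case: (phi _) => //; rewrite gt0_muley.
  rewrite !perspective_gt0E//.
  have := @fine_convex _ _ hphi _ _ (1 - l) r0 ler01 ltac:(lra) finr (fin_phi _ ltr01).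
  rewrite -qE// (transformation1 hphi) /= mulr0 addr0 => Hq.
  have qd : phi (q d / alpha d) \is a fin_num.
    by rewrite fin_phi// divr_gt0// /q ltr_wpDl ?mulr_gt0// mulr_ge0// subr_ge0 ltW.
  rewrite -(fineK qd) -(fineK finr) -!EFinM /= ler_pM2l//.
  apply: le_trans Hq _; rewrite ler_piMl//; last lra.
  by apply: fine_ge0; exact: transformation_ge0.
have := state_value_max theta qD finq; rewrite /state_value.
have -> : \sum_(d : A) q d * (val d) theta =
    \sum_(d : A) P theta d * (val d) theta + l * K.
  by rewrite mulr_sumr -big_split; apply: eq_bigr => d _; rewrite /q /=; ring.
rewrite [X in _ - X <= _](bigD1 c)//= [X in _ <= _ - X](bigD1 c)//=.
have le_rest : \sum_(d | d != c) fine (perspective phi (q d) (alpha d)) <=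
    \sum_(d | d != c) fine (perspective phi (P theta d) (alpha d)).
  exact: ler_sum.
have qcE : q c / alpha c = l.
  by rewrite qE// Pc0; ring.
rewrite !perspective_gt0E// qcE Pc0 mul0r.
rewrite -(fineK fin0) -(fineK (fin_phi _ l0)) -!EFinM /=.
move: slope; rewrite -(ltr_pM2l alphac).
have -> : alpha c * (l * (K / alpha c)) = l * K by field; rewrite gt_eqF.
lra.
Qed.

(* Averaging the choices of [a] and [b] leaves the payoff unchanged and strictly
   decreases the divergence unless the two likelihood ratios agree. *)
Lemma choice_ratio theta (a b : A) : (val a) theta = (val b) theta ->
  0 < alpha a -> 0 < alpha b ->
  P theta a / alpha a = P theta b / alpha b.
Proof.
move=> ab ap bp; have [Pc _] := hP; have [P0 P1] := Pc theta.
have [fin_phi _ _] := hsmooth.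
have [->//|neq_ab] := eqVneq a b.
apply/eqP/negPn/negP => neq_r.
have nba : b != a by rewrite eq_sym.
have s0 : 0 < alpha a + alpha b by rewrite addr_gt0.
(* The [alpha]-weighted average of the two ratios: giving it to both actions preserves their total
   probability, hence the payoff. *)
pose m := (P theta a + P theta b) / (alpha a + alpha b).
have m0 : 0 < m by rewrite divr_gt0// addr_gt0// choice_gt0.
pose q (d : A) := if d == a then alpha a * m
                  else if d == b then alpha b * m else P theta d.
have split_sum (F : A -> R) : \sum_d F d = F a + F b + \sum_(d | (d != a) && (d != b)) F d.
  by rewrite (bigD1 a)//= (bigD1 b)//= addrA.
have qa : q a = alpha a * m by rewrite /q eqxx.
have qb : q b = alpha b * m by rewrite /q (negbTE nba) eqxx.
have qr d : (d != a) && (d != b) -> q d = P theta d.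
  by rewrite /q => /andP[/negbTE-> /negbTE->].
have qsum : q a + q b = P theta a + P theta b.
  by rewrite qa qb /m; field; rewrite gt_eqF.
have qD : Delta q.
  split=> [d|].
    by rewrite /q; case: ifP => _; [|case: ifP => // _]; rewrite mulr_ge0// ltW.
  by rewrite split_sum qsum (eq_bigr _ qr) -split_sum.
have pa : perspective phi (q a) (alpha a) = (alpha a * fine (phi m))%:E.
  by rewrite perspective_gt0E// qa mulrC mulKf ?gt_eqF// EFinM fineK// fin_phi.
have pb : perspective phi (q b) (alpha b) = (alpha b * fine (phi m))%:E.
  by rewrite perspective_gt0E// qb mulrC mulKf ?gt_eqF// EFinM fineK// fin_phi.
have finq d : perspective phi (q d) (alpha d) \is a fin_num.
  have [->|da] := eqVneq d a; first by rewrite pa.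
  have [->|db] := eqVneq d b; first by rewrite pb.
  by rewrite qr ?da// perspective_fin_num.
have := state_value_max theta qD finq; rewrite /state_value.
rewrite !split_sum pa pb.
rewrite [X in _ + X - _](eq_bigr (fun d : A => P theta d * (val d) theta)); last first.
  by move=> d dab; rewrite qr.
rewrite [X in _ - (_ + X) <= _](eq_bigr (fun d : A =>
    fine (perspective phi (P theta d) (alpha d)))); last by move=> d dab; rewrite qr.
have -> : q a * (val a) theta + q b * (val b) theta =
    P theta a * (val a) theta + P theta b * (val b) theta.
  by rewrite ab -!mulrDl qsum.
(* Only the divergence terms of [a] and [b] remain, and strict convexity at [m] makes them strictly
   smaller for [q]. *)
rewrite lerD2l lerN2 lerD2r leNgt => /negP; apply.
have ra : 0 < P theta a / alpha a by rewrite divr_gt0// choice_gt0.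
have rb : 0 < P theta b / alpha b by rewrite divr_gt0// choice_gt0.
rewrite !perspective_gt0E//.
rewrite -(fineK (fin_phi _ ra)) -(fineK (fin_phi _ rb)) -!EFinM /=.
have l01 : 0 < alpha a / (alpha a + alpha b) < 1.
  by rewrite divr_gt0//= ltr_pdivrMr// mul1r ltrDl.
have := fine_strictly_convex hphi hsmooth ra rb neq_r l01.
have -> : alpha a / (alpha a + alpha b) * (P theta a / alpha a) +
    (1 - alpha a / (alpha a + alpha b)) * (P theta b / alpha b) = m.
  by rewrite /m; field; rewrite !gt_eqF.
rewrite -(ltr_pM2l s0) => /=.
set fa := fine _; set fb := fine _; set fm := fine _.
have -> : (alpha a + alpha b) * (alpha a / (alpha a + alpha b) * fb +
    (1 - alpha a / (alpha a + alpha b)) * fm) = alpha a * fb + alpha b * fm.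
  by field; rewrite gt_eqF.
by rewrite mulrDl.
Qed.

End Optimality.

Theorem proposition3 (R : realType) (Theta : finType) (phi : R -> \bar R)
  (pi : Theta -> R) (A : {fset action R Theta}) (P : Theta -> A -> R)
  (alpha : A -> R) (a b : A)
  (hphi : transformation phi) (hsmooth : essentially_smooth phi)
  (hpiA : decision_problem pi A)
  (hP : optimal phi pi P)
  (halpha : fmean phi pi P alpha)
  (hab : comparable_actions a b) :
  more_salient P a b <-> alpha b <= alpha a.
Proof.
have [[alpha0 _] _] := halpha.
have P_gt0 theta c : 0 < alpha c -> 0 < P theta c.
  exact: (choice_gt0 hphi hsmooth hpiA hP halpha).
have P_eq0 theta c : alpha c = 0 -> P theta c = 0.
  exact: (choice_eq0 hphi hpiA hP halpha).
(* An equivalence in every tied state, so the one state given by comparability suffices to recover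
   the order of [alpha]. *)
have same theta : (val a) theta = (val b) theta ->
    (P theta b <= P theta a) = (alpha b <= alpha a).
  (* If [alpha b = 0] both inequalities hold; if [alpha a = 0 < alpha b] both fail; otherwise both
     choices are [alpha] times one positive ratio. *)
  move=> ab; have := alpha0 b; rewrite le_eqVlt => /predU1P[b0|b0].
    by rewrite -b0 P_eq0// alpha0; have [Pc _] := hP; have [-> _] := Pc theta.
  have := alpha0 a; rewrite le_eqVlt => /predU1P[a0|a0].
    by rewrite -a0 (P_eq0 theta a)// !leNgt b0 P_gt0.
  have r := choice_ratio hphi hsmooth hpiA hP halpha ab a0 b0.
  have -> : P theta b = P theta a / alpha a * alpha b by rewrite r divfK ?gt_eqF.
  rewrite -[leRHS](divfK (lt0r_neq0 a0)).
  by rewrite ler_pM2l// divr_gt0// P_gt0.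
split=> [sal|le_ba theta ab]; last by rewrite same.
by have [theta ab] := hab; rewrite -(same theta)//; exact: sal.
Qed.
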